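(* The equivalence relation $E_0^{[\mathbb Z]}$ is generically ergodic with respect to actions of TSI groups; that is, for every TSI Polish group $H$ and every Polish $H$-space $Y$, $E_0^{[\mathbb Z]}$ is generically $E^H_Y$-ergodic.
   Context: $E_0$ is the equivalence relation of eventual equality on $2^{\mathbb N}$: $x\,E_0\,y$ iff $x(n)=y(n)$ for all but finitely many $n$. For a countable group $\Gamma$ and an equivalence relation $E$ on a Polish space $X$, the $\Gamma$-jump $E^{[\Gamma]}$ is the equivalence relation on $X^\Gamma$ given by $$x\,E^{[\Gamma]}\,x'\iff(\exists\gamma\in\Gamma)(\forall\alpha\in\Gamma)\; x(\gamma^{-1}\alpha)\,E\,x'(\alpha).$$ Thus $E_0^{[\mathbb Z]}$ is an equivalence relation on the Polish space $(2^{\mathbb N})^{\mathbb Z}$. A Polish group is TSI if it admits a compatible two-side invariant metric. A Polish $H$-space is a Polish space $Y$ with a continuous left action of the Polish group $H$, and $E^H_Y$ is its orbit equivalence relation. For equivalence relations $E$ on $X$ and $F$ on $Y$ ($X,Y$ Polish), a Baire-measurable homomorphism from $E$ to $F$ is a Baire-measurable $f:X\to Y$ with $x\,E\,x'\Rightarrow f(x)\,F\,f(x')$; $E$ is generically $F$-ergodic if for every such $f$ there is a comeager $C\subseteq X$ such that $f(x)\,F\,f(x')$ for all $x,x'\in C$. *)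

(* Defs.v *)
From HB Require Import structures.
From mathcomp Require Import all_boot all_order all_algebra.
From mathcomp Require Import all_classical all_reals all_analysis.

Set Implicit Arguments.
Unset Strict Implicit.
Unset Printing Implicit Defensive.

Local Open Scope classical_set_scope.
Local Open Scope ring_scope.

Section polish.
Context {R : realType} {T : topologicalType}.
Implicit Types d : T -> T -> R.

(* Nonnegativity follows from the four axioms. *)
Definition is_metric d :=
  [/\ forall x, d x x = 0,
      forall x y, d x y = 0 -> x = y,
      forall x y, d x y = d y x &
      forall x y z, d x z <= d x y + d y z].

Definition compatible_metric d :=
  is_metric d /\
  forall (x : T) (A : set T),
    nbhs x A <-> exists2 e : R, 0 < e & [set y | d x y < e] `<=` A.

Definition complete_metric d :=
  forall u : nat -> T,
    (forall e : R, 0 < e ->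
      exists N : nat, forall m n : nat,
        (N <= m)%N -> (N <= n)%N -> d (u m) (u n) < e) ->
    exists l : T, forall e : R, 0 < e ->
      exists N : nat, forall n : nat, (N <= n)%N -> d (u n) l < e.

End polish.

Definition separable (T : topologicalType) :=
  exists2 D : set T, countable D & dense D.

(* The realType R only serves as the codomain of the metrics. *)
Definition polish (R : realType) (T : topologicalType) :=
  separable T /\
  exists d : T -> T -> R, compatible_metric d /\ complete_metric d.

Section category.
Context {T : topologicalType}.
Implicit Types A : set T.

Definition nowhere_dense A := interior (closure A) = set0.

Definition meager A :=
  exists2 F : nat -> set T,
    forall n, nowhere_dense (F n) & A `<=` \bigcup_n F n.

Definition comeager A := meager (~` A).

Definition baire_property A :=
  exists2 U : set T, open U & meager ((A `\` U) `|` (U `\` A)).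

End category.

Definition baire_measurable (X Y : topologicalType) (f : X -> Y) :=
  forall V : set Y, open V -> baire_property (f @^-1` V).

Definition homomorphism (X Y : Type) (E : X -> X -> Prop) (F : Y -> Y -> Prop)
    (f : X -> Y) :=
  forall x x' : X, E x x' -> F (f x) (f x').

Definition generically_ergodic (X Y : topologicalType)
    (E : X -> X -> Prop) (F : Y -> Y -> Prop) :=
  forall f : X -> Y, baire_measurable f -> homomorphism E F f ->
    exists2 C : set X, comeager C &
      forall x x' : X, C x -> C x' -> F (f x) (f x').

HB.mixin Record isTopologicalGroup G & Topological G & Group G := {
  mulg_continuous : continuous (fun p : G * G => (p.1 * p.2)%g) ;
  invg_continuous : continuous (fun x : G => (x^-1)%g)
}.

#[short(type="topologicalGroupType")]
HB.structure Definition TopologicalGroup :=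
  {G of Topological G & Group G & isTopologicalGroup G}.

Definition TSI (R : realType) (H : topologicalGroupType) :=
  exists2 d : H -> H -> R, compatible_metric d &
    forall g x y : H,
      d (g * x)%g (g * y)%g = d x y /\ d (x * g)%g (y * g)%g = d x y.

Definition continuous_action (H : topologicalGroupType) (Y : topologicalType)
    (act : H -> Y -> Y) :=
  [/\ forall y, act 1%g y = y,
      forall g h y, act (g * h)%g y = act g (act h y) &
      continuous (fun p : H * Y => act p.1 p.2)].

Definition orbit_rel (H : topologicalGroupType) (Y : topologicalType)
    (act : H -> Y -> Y) (y y' : Y) :=
  exists g : H, act g y = y'.

Definition E0 (x y : cantor_space) := \forall n \near \oo, x n = y n.

(* X^Gamma carries the product topology, with Gamma a bare index set. *)
Definition jump (Gamma : groupType) (X : Type) (E : X -> X -> Prop)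
    (x x' : {ptws Gamma -> X}) :=
  exists g : Gamma, forall a : Gamma, E (x (g^-1 * a)%g) (x' a).

(* The additive group of integers, written multiplicatively. *)
Definition Zgrp : groupType := Algebra.to_multiplicative int.

(* Main.v *)
Require Import Defs.
From Stdlib Require PeanoNat.
From mathcomp Require Import all_boot all_order all_algebra.
From mathcomp Require Import all_classical all_reals all_analysis.
From mathcomp Require Import zify lra.

(** On Z-indexed families of points of Cantor space, consider the shifts and
    the flips, where a flip changes finitely many bits at every index in Z.
    Both move a family inside its class for the jump of E_0, and this is all
    that the proof uses of that relation.  Let f be a homomorphism from it to the
    orbit relation of a TSI group H, let d be an invariant metric on H, and
    call y and y' e-close when y' = w y for some w with d(1,w) <= e.  Since d
    is two-sided invariant, e-closeness is preserved when the same element of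
    H is applied to both points.

    The heart of the proof is that f is locally almost constant along flips
    (locally_constant_on_flips): every nonempty open set contains a nonempty
    open set V on which, generically, f u and f v are e-close whenever v is a
    flip of u.
    - By orbit continuity (orbit_continuity), f u and f v are e-close if u
      and v lie in a suitable basic open set U, determined by a window of
      indices around 0, if v is a flip of u, and if u and v are equal on that
      window.
    - Let t be a shift that takes a far away window to that one.  The relation
      f (t x) = w (f x) defines w only up to a stabilizer, but w can be taken
      within e of a fixed h for generic x in an open set V
      (locally_constant_cocycle).  So if f (t u) and f (t z) are close, then
      so are h (f u) and h (f z), hence also f u and f z.  This is where
      two-sided invariance is used.
    - Given u and a flip v of u in V, take two disjoint far away windows and a
      flip z of u that equals u on the first and v on the second.  The two
      corresponding shifts show that f u is close to f z and f z to f v.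

    Now let x and y be generic.  The flips of y are dense, so there are flips
    z_j of y that converge to x and such that z_j and z_(j+1) both lie in a set
    V as above, with e = 2^-j, that contains x.  Then f z_(j+1) = w_j (f z_j)
    with d(1,w_j) <= 2^-j, the products w_j ... w_0 converge because d is
    complete (tsi_complete), and their limit takes f z_0 to the limit f x of
    the f z_j (orbit_limit).  So f x is in the orbit of f y (generic_single_orbit).

    The only descriptive set theory involved is a Baire category uniformization
    theorem (generic_uniformization), which replaces the Baire property of
    analytic sets. *)

Set Implicit Arguments.
Unset Strict Implicit.
Unset Printing Implicit Defensive.

Import Order.TTheory GRing.Theory Num.Theory.
Local Open Scope classical_set_scope.

(** * Meager and comeager sets *)

Section meager_theory.
Context {T : topologicalType}.
Implicit Types A B U : set T.

Lemma nowhere_denseP A :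
  nowhere_dense A <->
  forall U, open U -> U !=set0 ->
    exists V, [/\ open V, V !=set0, V `<=` U & V `&` A = set0].
Proof.
split=> [ndA U oU [x Ux]|H].
- have [y Uy nAy] : exists2 y, U y & ~ closure A y.
    apply: contrapT => /forall2NP H.
    have : interior (closure A) x.
      apply: filterS (open_nbhs_nbhs (conj oU Ux)) => y Uy.
      by have [|/contrapT] := H y.
    by rewrite ndA.
  exists (U `&` ~` closure A); split.
  + by apply: openI => //; exact/closed_openC/closed_closure.
  + by exists y.
  + by move=> z [].
  + rewrite -subset0 => z [[_ nAz] Az]; apply: nAz; exact: subset_closure.
- rewrite /nowhere_dense -subset0 => x xA.
  have [V [oV [y Vy] Vi VA]] := H _ (@open_interior _ (closure A))
    (ex_intro _ x xA).
  have [|z [Az Vz]] := interior_subset (Vi _ Vy) V.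
  + exact: open_nbhs_nbhs.
  + by have : set0 z by rewrite -VA.
Qed.

Lemma nowhere_dense0 : nowhere_dense (@set0 T).
Proof. by rewrite /nowhere_dense closure0 -subset0; exact: interior_subset. Qed.

Lemma meager_sub A B : A `<=` B -> meager B -> meager A.
Proof. by move=> AB [F ndF BF]; exists F => //; exact: subset_trans BF. Qed.

Lemma meager_nowhere_dense A : nowhere_dense A -> meager A.
Proof. by move=> ndA; exists (fun=> A) => // x Ax; exists 0%N. Qed.

(** Indexing by an arbitrary countable type spares the later proofs from coding
    pairs and finite sequences as natural numbers. *)
Lemma meager_bigcup (I : countType) (F : I -> set T) :
  (forall i, meager (F i)) -> meager (\bigcup_i F i).
Proof.
move=> mF.
pose G (i : I) : nat -> set T := projT1 (cid2 (mF i)).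
have ndG i n : nowhere_dense (G i n) by rewrite /G; case: cid2 => /=.
have FG i : F i `<=` \bigcup_n G i n by rewrite /G; case: cid2 => /=.
exists (fun k => if @unpickle (I * nat)%type k is Some p then G p.1 p.2
                 else set0).
  by move=> k; case: unpickle => [p|]; [exact: ndG|exact: nowhere_dense0].
by move=> x [i _ /FG[n _ Gx]]; exists (pickle (i, n)) => //=; rewrite pickleK.
Qed.

Lemma meagerU A B : meager A -> meager B -> meager (A `|` B).
Proof.
move=> mA mB; have := @meager_bigcup bool (fun b => if b then A else B).
case; first by case.
move=> F ndF AF; exists F => //; apply: subset_trans AF => x [Ax|Bx].
  by exists true.
by exists false.
Qed.

Lemma comeager_sub A B : A `<=` B -> comeager A -> comeager B.
Proof. by move=> AB; apply: meager_sub; exact: subsetC. Qed.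

Lemma comeager_bigcap (I : countType) (F : I -> set T) :
  (forall i, comeager (F i)) -> comeager (\bigcap_i F i).
Proof.
by move=> cF; rewrite /comeager setC_bigcap; apply: meager_bigcup.
Qed.

Lemma comeagerI A B : comeager A -> comeager B -> comeager (A `&` B).
Proof. by move=> cA cB; rewrite /comeager setCI; exact: meagerU. Qed.

Lemma comeagerT : comeager (@setT T).
Proof.
by rewrite /comeager setCT; exact/meager_nowhere_dense/nowhere_dense0.
Qed.

Lemma comeager_open_dense U :
  open U -> (forall Q, open Q -> Q !=set0 -> U `&` Q !=set0) -> comeager U.
Proof.
move=> oU dO; apply/meager_nowhere_dense/nowhere_denseP => Q oQ Q0.
exists (U `&` Q); split; [exact: openI|exact: dO|exact: subIsetr|].
by rewrite setIAC setICr set0I.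
Qed.

Lemma nonmeager_comeager A B : ~ meager A -> comeager B -> ~ meager (A `&` B).
Proof.
move=> nA cB mAB; apply: nA; apply: meager_sub (meagerU mAB cB) => x Ax.
by have [Bx|nBx] := pselect (B x); [left|right].
Qed.

Lemma nonmeager_nonempty A : ~ meager A -> A !=set0.
Proof.
move=> nA; apply/set0P/eqP => A0; apply: nA; rewrite A0.
exact/meager_nowhere_dense/nowhere_dense0.
Qed.

Definition countable_base (b : nat -> set T) :=
  (forall n, open (b n)) /\
  (forall x A, nbhs x A -> exists2 n, b n x & b n `<=` A).

Definition thick A U :=
  forall V, open V -> V !=set0 -> V `<=` U -> ~ meager (A `&` V).

(** Otherwise the basic open subsets of U in which A is meager have a union
    that is dense in U; A is meager in that union because there are only
    countably many of them, and what is left of U is nowhere dense. *)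
Lemma nonmeager_thick b A U : countable_base b -> open U ->
  ~ meager (A `&` U) ->
  exists V, [/\ open V, V !=set0, V `<=` U & thick A V].
Proof.
move=> [ob bb] oU nm; apply: contrapT => H; apply: nm.
pose J n := b n `<=` U /\ meager (A `&` b n).
pose G := \bigcup_(n in J) b n.
have ndOG : nowhere_dense (U `\` G).
  apply/nowhere_denseP => Q oQ [x Qx].
  have [[y [Qy Uy]]|QO] := pselect ((Q `&` U) !=set0); last first.
    exists Q; split=> //; first by exists x.
    by rewrite -subset0 => z [Qz [Uz _]]; apply: QO; exists z.
  have : ~ thick A (Q `&` U).
    move=> tA; apply: H; exists (Q `&` U); split=> //; first exact: openI.
      by exists y.
  rewrite /thick => /existsNP[V /not_implyP[oV /not_implyP[[z Vz]]]].
  move=> /not_implyP[VQ /contrapT mV].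
  have [n bnz bnV] := bb z V (open_nbhs_nbhs (conj oV Vz)).
  exists (b n); split=> //; first by exists z.
    by move=> t /bnV/VQ[].
  rewrite -subset0 => t [bt [_]]; apply; exists n => //; split.
    by move=> t' /bnV/VQ[].
  by apply: meager_sub mV; apply: setIS.
have mJ : meager (\bigcup_n (if pselect (J n) then A `&` b n else set0)).
  apply: meager_bigcup => n; case: pselect => [[]|nJ] /=; first by [].
  exact/meager_nowhere_dense/nowhere_dense0.
apply: meager_sub (meagerU mJ (meager_nowhere_dense ndOG)) => x [Ax Ux].
have [[n Jn bx]|nGx] := pselect (G x); last by right.
by left; exists n => //; case: pselect.
Qed.

(** The largest open set in which A is thick. *)
Definition thick_part A := \bigcup_(U in [set U | open U /\ thick A U]) U.

(** Inside any open subset of the thick part of A some B i is nonmeager, so by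
    [nonmeager_thick] it is thick in a smaller open set.  Hence the thick parts
    of the B i form an open set that is dense in the thick part of A. *)
Lemma thick_part_split b A (B : nat -> set T) : countable_base b ->
  A `<=` \bigcup_i B i ->
  nowhere_dense (thick_part A `\` \bigcup_i thick_part (B i)).
Proof.
move=> bb AB; apply/nowhere_denseP => Q oQ [x Qx].
have [[y [Qy [U [oU tU] Uy]]]|QA] :=
  pselect ((Q `&` thick_part A) !=set0); last first.
  exists Q; split=> //; first by exists x.
  by rewrite -subset0 => z [Qz [Uz _]]; apply: QA; exists z.
have [i nmB] : exists i, ~ meager (B i `&` (Q `&` U)).
  apply: contrapT => /forallNP mB.
  apply: (tU (Q `&` U)); [exact: openI|by exists y|by move=> z []|].
  apply: meager_sub (meager_bigcup (fun i => contrapT (mB i))) => z [Az QOz].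
  by have [i _ Biz] := AB z Az; exists i.
have [V [oV V0 VQO tV]] := nonmeager_thick bb (openI oQ oU) nmB.
exists V; split=> //; first by move=> z /VQO[].
by rewrite -subset0 => z [Vz [_]]; apply; exists i => //; exists V.
Qed.

Lemma thick_part_adherent A x Q :
  thick_part A x -> nbhs x Q -> exists2 y, A y & Q y.
Proof.
move=> [U [oU tU] Ux] /nbhs_interior xQ.
have oQ : open Q° by exact: open_interior.
have [||y [Ay [Qy _]]] :=
    nonmeager_nonempty (tU (Q° `&` U) (openI oQ oU) _ _).
- by exists x; split=> //; exact: nbhs_singleton xQ.
- by move=> z [].
- by exists y => //; exact: interior_subset.
Qed.

End meager_theory.

(** * Category in products *)

Section preimage.
Context {Z X : topologicalType} (p : Z -> X).
Hypothesis p_cont : continuous p.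
Hypothesis p_open : forall U, open U -> U !=set0 ->
  exists V, [/\ open V, V !=set0 & V `<=` p @` U].

Lemma nowhere_dense_preimage A : nowhere_dense A -> nowhere_dense (p @^-1` A).
Proof.
move=> /nowhere_denseP ndA; apply/nowhere_denseP => U oU U0.
have [V [oV V0 VU]] := p_open oU U0.
have [W [oW [x Wx] WV WA]] := ndA V oV V0.
exists (U `&` p @^-1` W); split.
- by apply: openI => //; apply: open_comp => // z _; exact: p_cont.
- by have [z Uz pz] := VU x (WV x Wx); exists z; split=> //=; rewrite pz.
- exact: subIsetl.
- by rewrite -subset0 => z [[_ Wz] Az]; have : set0 (p z) by rewrite -WA.
Qed.

Lemma meager_preimage A : meager A -> meager (p @^-1` A).
Proof.
move=> [F ndF AF]; exists (fun n => p @^-1` (F n)).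
  by move=> n; exact: nowhere_dense_preimage.
by move=> z /AF[n _ Fz]; exists n.
Qed.

Lemma comeager_preimage A : comeager A -> comeager (p @^-1` A).
Proof. exact: meager_preimage. Qed.

End preimage.

Section kuratowski_ulam.
Context {X G : topologicalType} (b : nat -> set G).
Hypothesis b_base : countable_base b.

(** The exceptional x are those whose section of the closure of F contains some
    basic open set b m.  For each m they form a nowhere dense set, because any
    box above b m contains a smaller box that misses F. *)
Lemma section_nowhere_dense (F : set (X * G)) : nowhere_dense F ->
  exists2 M : set X, meager M &
    forall x, ~ M x -> nowhere_dense [set g | F (x, g)].
Proof.
move=> ndF; have [ob bb] := b_base.
pose W m := [set x : X | b m !=set0 /\ forall g, b m g -> closure F (x, g)].
exists (\bigcup_m W m).
  apply: meager_bigcup => m; apply: meager_nowhere_dense.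
  apply/nowhere_denseP => Q oQ [x Qx].
  have [bm0|bm0] := pselect (b m !=set0); last first.
    exists Q; split=> //; first by exists x.
    by rewrite -subset0 => z [_ []].
  have [[x0 g0] [/= Qx0 bg0] nF] : exists2 z, (Q `*` b m) z & ~ closure F z.
    apply: contrapT => /forall2NP H; have [g bg] := bm0.
    have : interior (closure F) (x, g).
      exists (Q, b m); first split => /=.
      - exact: open_nbhs_nbhs.
      - exact: (open_nbhs_nbhs (conj (ob m) bg)).
      by move=> z Qz; have [|/contrapT] := H z.
    by rewrite ndF.
  have [[A B] [/= nA nB] AB] : nbhs (x0, g0) (~` closure F).
    by apply: open_nbhs_nbhs; split=> //; exact/closed_openC/closed_closure.
  exists (A° `&` Q); split.
  - by apply: openI => //; exact: open_interior.
  - by exists x0; split=> //; exact: nA.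
  - exact: subIsetr.
  - rewrite -subset0 => z [[Az _] [_ Wz]].
    apply: (AB (z, g0)); last exact: Wz.
    by split => /=; [exact: interior_subset|exact: nbhs_singleton].
move=> x nM; apply/nowhere_denseP => Q oQ [g Qg].
have [m bg bQ] := bb g Q (open_nbhs_nbhs (conj oQ Qg)).
have [h bh nF] : exists2 h, b m h & ~ closure F (x, h).
  apply: contrapT => /forall2NP H; apply: nM; exists m => //.
  split; first by exists g.
  by move=> h bh; have [|/contrapT] := H h.
have [[A B] [/= nA nB] AB] : nbhs (x, h) (~` closure F).
  by apply: open_nbhs_nbhs; split=> //; exact/closed_openC/closed_closure.
exists (B° `&` b m); split.
- by apply: openI; [exact: open_interior|exact: ob].
- by exists h; split.
- by move=> z [_ /bQ].
- rewrite -subset0 => z [[Bz _] Fz].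
  apply: (AB (x, z)); last exact: subset_closure.
  by split => /=; [exact: nbhs_singleton|exact: interior_subset].
Qed.

(** The Kuratowski-Ulam theorem, in the direction from the product to the
    sections. *)
Lemma kuratowski_ulam (D : set (X * G)) : comeager D ->
  comeager [set x | comeager [set g | D (x, g)]].
Proof.
move=> [F ndF DF].
pose M n := projT1 (cid2 (section_nowhere_dense (ndF n))).
apply: (@meager_sub _ _ (\bigcup_n M n)); last first.
  by apply: meager_bigcup => n; rewrite /M; case: cid2.
move=> x nD; apply: contrapT => nM; apply: nD.
exists (fun n => [set g | F n (x, g)]).
  move=> n; have : ~ M n x by move=> Mx; apply: nM; exists n.
  by rewrite /M; case: cid2 => /= M' _; exact.
by move=> g /DF[n _ Fg]; exists n.
Qed.

End kuratowski_ulam.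

(** * Spaces with a complete sequence of equivalence relations *)

(** A presentation of a space as the set of branches of a countably branching
    tree: c n x y says that x and y agree up to level n.  Unlike complete
    ultrametrics, these presentations pass to countable products without any
    choice of weights, and they are all that the category arguments need:
    [cyl_lim] gives the Baire property and [cyl_code], which says that there
    are countably many classes at each level, gives a countable base. *)
Record cylinders (T : topologicalType) (c : nat -> T -> T -> Prop) : Prop := {
  cyl_refl : forall n x, c n x x ;
  cyl_sym : forall n x y, c n x y -> c n y x ;
  cyl_trans : forall n x y z, c n x y -> c n y z -> c n x z ;
  cylS : forall n x y, c n.+1 x y -> c n x y ;
  cyl_nbhs : forall x A, nbhs x A <-> exists n, c n x `<=` A ;
  cyl_lim : forall u : nat -> T, (forall n, c n (u n) (u n.+1)) ->
    exists x, forall n, c n (u n) x ;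
  cyl_code : forall n, exists k : T -> nat, forall x y, k x = k y -> c n x y }.

Section cylinders_theory.
Context {T : topologicalType} {c : nat -> T -> T -> Prop} (cT : cylinders c).

Lemma cyl_le m n x y : (m <= n)%N -> c n x y -> c m x y.
Proof.
move=> /subnK <-; elim: (n - m)%N => //= k IH.
by rewrite addSn => /(cylS cT); exact: IH.
Qed.

Lemma cyl_open n x : open (c n x).
Proof.
rewrite openE => y cxy; apply/(cyl_nbhs cT); exists n => z.
exact: cyl_trans cT _ _ _ _ cxy.
Qed.

Lemma open_cyl (U : set T) x : open U -> U x -> exists n, c n x `<=` U.
Proof. by move=> oU Ux; apply/(cyl_nbhs cT); exact: open_nbhs_nbhs. Qed.

Lemma cyl_countable_base : exists b : nat -> set T, countable_base b.
Proof.
pose k n := projT1 (cid (cyl_code cT n)).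
have kP n x y : k n x = k n y -> c n x y by rewrite /k; case: cid => /= ? H /H.
pose B (p : nat * nat) := [set y | exists2 x, k p.1 x = p.2 & c p.1 x y].
exists (fun m => if @unpickle (nat * nat)%type m is Some p then B p else set0).
split=> [m|x A /(cyl_nbhs cT)[n nA]].
  case: unpickle => [p|]; last exact: open0.
  have -> : B p = \bigcup_(x in [set x | k p.1 x = p.2]) c p.1 x.
    by apply/seteqP; split=> y [x ? ?]; exists x.
  by apply: bigcup_open => x _; exact: cyl_open.
exists (pickle (n, k n x)); rewrite pickleK.
  by exists x => //=; exact: cyl_refl cT _ _.
move=> y [z /= /kP czx czy]; apply: nA.
by apply: cyl_trans cT _ _ _ _ _ czy; exact: cyl_sym.
Qed.

(** Shrink cylinders to avoid the nowhere dense sets F 0, F 1, ... one after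
    the other; the centers form a sequence that converges inside all of the
    cylinders. *)
Lemma cyl_baire (U : set T) : open U -> U !=set0 -> ~ meager U.
Proof.
move=> oU [x0 Ux0] [F ndF UF].
have [n0 n0U] := open_cyl oU Ux0.
have step (k : nat) (p : nat * T) : {q : nat * T |
    [/\ (p.1 < q.1)%N, c p.1 p.2 q.2 & c q.1 q.2 `&` F k = set0]}.
  apply: cid.
  have [V [oV [y Vy] Vp VF]] := (@nowhere_denseP _ (F k)).1 (ndF k) _
    (cyl_open p.1 p.2) (ex_intro _ _ (cyl_refl cT p.1 p.2)).
  have [m mV] := open_cyl oV Vy.
  exists (maxn m p.1.+1, y) => /=; split; [by rewrite leq_maxr|exact: Vp|].
  rewrite -subset0 -VF => z [cz Fz]; split=> //; apply: mV.
  by apply: cyl_le cz; rewrite leq_maxl.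
pose u := fix u k := if k is k'.+1 then projT1 (step k' (u k')) else (n0, x0).
have uS k : [/\ ((u k).1 < (u k.+1).1)%N, c (u k).1 (u k).2 (u k.+1).2 &
    c (u k.+1).1 (u k.+1).2 `&` F k = set0].
  by rewrite /=; case: (step k (u k)).
have u_ge k : (k <= (u k).1)%N.
  by elim: k => // k IH; have [+ _ _] := uS k; exact: leq_ltn_trans.
have u_mono k j : ((u k).1 <= (u (j + k)%N).1)%N.
  elim: j => // j IH; have [+ _ _] := uS (j + k)%N.
  by move=> /ltnW; exact: leq_trans IH.
have [k|x xP] := @cyl_lim _ _ cT (fun k => (u k).2).
  by have [_ + _] := uS k; apply: cyl_le.
have ux k : c (u k).1 (u k).2 x.
  have H j : c (u k).1 (u k).2 (u (j + k)%N).2.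
    elim: j => [|j IH]; first exact: cyl_refl cT _ _.
    apply: cyl_trans cT _ _ _ _ IH _; have [_ + _] := uS (j + k)%N.
    by apply: cyl_le; exact: u_mono.
  apply: cyl_trans cT _ _ _ _ (H (u k).1) _.
  by apply: cyl_le (xP _); rewrite leq_addr.
have [k _ Fx] : (\bigcup_n F n) x by apply/UF/n0U/(ux 0%N).
have [_ _] := uS k; rewrite -subset0 => /(_ x); apply; split=> //.
Qed.

Lemma comeager_meets (A U : set T) : comeager A -> open U -> U !=set0 ->
  exists2 x, A x & U x.
Proof.
move=> cA oU U0; have := nonmeager_comeager (cyl_baire oU U0) cA.
by move=> /nonmeager_nonempty[x [Ux Ax]]; exists x.
Qed.

End cylinders_theory.

Lemma cylinders_discrete (T : topologicalType) (k : T -> nat) : injective k ->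
  (forall (x : T) A, nbhs x A <-> A x) ->
  cylinders (fun (_ : nat) (x y : T) => x = y).
Proof.
move=> kI nT; split=> //.
- by move=> _ x y z ->.
- move=> x A; rewrite nT; split=> [Ax|[_]]; last exact.
  by exists 0%N => y <-.
- by move=> u uS; exists (u 0%N) => n; elim: n => // n <-.
- by move=> _; exists k; exact: kI.
Qed.

(** Level n of the product only looks at the coordinates of rank below n, each
    of them at level n; the lists s n make these finitely many. *)
Lemma cylinders_ptws (I : eqType) (T : topologicalType) c
    (r : I -> nat) (s : nat -> seq I) :
  (forall n i, (r i < n)%N -> i \in s n) ->
  cylinders (T := T) c ->
  cylinders (T := {ptws I -> T})
    (fun n x y => forall i, (r i < n)%N -> c n (x i) (y i)).
Proof.
move=> rs cT; split.
- by move=> n x i _; exact: cyl_refl cT _ _.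
- by move=> n x y H i ri; apply/(cyl_sym cT)/H.
- by move=> n x y z H K i ri; apply: cyl_trans cT _ _ _ _ (H i ri) (K i ri).
- by move=> n x y H i ri; apply/(cylS cT)/H; exact: ltnW.
- move=> x A; split=> [xA|[n nA]].
    pose F : set_system {ptws I -> T} := [set A | exists n,
      [set y | forall i, (r i < n)%N -> c n (x i) (y i)] `<=` A].
    have FF : Filter F.
      split.
      + by exists 0%N.
      + move=> B C [m mB] [n nC]; exists (maxn m n) => y H; split.
          apply: mB => i ri; apply: (cyl_le cT (leq_maxl m n)).
          by apply: H; rewrite leq_max ri.
        apply: nC => i ri; apply: (cyl_le cT (leq_maxr m n)).
        by apply: H; rewrite leq_max ri orbT.
      + by move=> B C BC [n nB]; exists n; exact: subset_trans BC.
    suff : F --> x by move/(_ A xA).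
    apply/cvg_sup => i B; rewrite nbhsE => -[_ [[V oV <-] Vx] VB].
    apply: (@filterS _ F _ _ _ VB).
    have [n nV] := (cyl_nbhs cT (x i) V).1 (open_nbhs_nbhs (conj oV Vx)).
    exists (maxn n (r i).+1) => y H; apply: nV.
    by apply: (cyl_le cT (leq_maxl n (r i).+1)); apply: H; rewrite leq_maxr.
  apply: filterS nA _; apply: (@filterS _ _ _
      [set y : {ptws I -> T} | forall i, i \in s n -> c n (x i) (y i)]).
    by move=> y H i /rs /H.
  elim: (s n) => [|i l IH]; first by apply: filterS filterT.
  have : nbhs x [set y : {ptws I -> T} | c n (x i) (y i)].
    apply: (@proj_continuous _ (fun=> T) i x); apply/(cyl_nbhs cT).
    by exists n.
  move=> /filterI/(_ IH); apply: filterS => y [yi yl] j.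
  by rewrite inE => /orP[/eqP ->|/yl].
- move=> u uS.
  (* Coordinate i is controlled only after stage r i, so the sequence is
     frozen before that stage. *)
  have H i : exists z, forall n, c n (u (maxn n (r i).+1) i) z.
    apply: (cyl_lim cT) => n.
    have [nr|rn] := leqP n (r i).
      rewrite (maxn_idPr _) ?leqW// (maxn_idPr _)//.
      exact: cyl_refl cT _ _.
    rewrite (maxn_idPl _)// (maxn_idPl _) ?leqW//.
    exact: uS.
  exists (fun i => projT1 (cid (H i))) => n i rn; case: cid => /= z /(_ n).
  by rewrite (maxn_idPl _).
- move=> n; have [k kP] := cyl_code cT n.
  exists (fun x => pickle [seq k (x i) | i <- s n]) => x y E i ri.
  apply: kP; have := pcan_inj (@pickleK _) E.
  by move=> /eq_in_map; apply; exact: rs.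
Qed.

Lemma cylinders_prod (X G : topologicalType) c d :
  cylinders (T := X) c -> cylinders (T := G) d ->
  cylinders (T := (X * G)%type) (fun n p q => c n p.1 q.1 /\ d n p.2 q.2).
Proof.
move=> cX cG; split.
- by move=> n p; split; [exact: cyl_refl cX _ _|exact: cyl_refl cG _ _].
- move=> n p q [? ?].
  by split; [exact: cyl_sym cX _ _ _ _|exact: cyl_sym cG _ _ _ _].
- move=> n p q t [p1 p2] [q1 q2]; split.
    exact: cyl_trans cX _ _ _ _ p1 q1.
  exact: cyl_trans cG _ _ _ _ p2 q2.
- by move=> n p q [? ?]; split; [exact: cylS cX _ _ _ _|exact: cylS cG _ _ _ _].
- move=> [x g] A; split=> [[[P Q] /= [/(cyl_nbhs cX)[m mP]]]|[n nA]].
    move=> /(cyl_nbhs cG)[n nQ] PQ; exists (maxn m n) => q [q1 q2]; apply: PQ.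
    split=> /=; [apply: mP|apply: nQ].
      by apply: (cyl_le cX) q1; rewrite leq_maxl.
    by apply: (cyl_le cG) q2; rewrite leq_maxr.
  exists (c n x, d n g) => //=.
  by split; [apply/(cyl_nbhs cX); exists n|apply/(cyl_nbhs cG); exists n].
- move=> u uS.
  have [n|x xP] := @cyl_lim _ _ cX (fun n => (u n).1); first by have [] := uS n.
  have [n|g gP] := @cyl_lim _ _ cG (fun n => (u n).2); first by have [] := uS n.
  by exists (x, g).
- move=> n; have [k kP] := cyl_code cX n; have [l lP] := cyl_code cG n.
  exists (fun p => pickle (k p.1, l p.2)) => p q /(pcan_inj (@pickleK _)).
  by move=> [/kP ? /lP].
Qed.

Local Open Scope ring_scope.

(** * Metrics *)

Section metric_theory.
Context {R : realType} {T : topologicalType} (d : T -> T -> R).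
Hypothesis dT : compatible_metric d.

Let d0 x : d x x = 0. Proof. by have [[]] := dT. Qed.
Let dC x y : d x y = d y x. Proof. by have [[]] := dT. Qed.
Let dD x y z : d x z <= d x y + d y z. Proof. by have [[]] := dT. Qed.

Lemma metric_ge0 x y : 0 <= d x y.
Proof. by have := dD x y x; rewrite d0 (dC y x); lra. Qed.

Lemma metric_gt0 x y : x <> y -> 0 < d x y.
Proof.
move=> xy; rewrite lt_neqAle metric_ge0 andbT; apply/eqP => /esym E.
by apply: xy; have [[_ + _ _] _] := dT; apply.
Qed.

Lemma nbhs_metric_ball x (e : R) : 0 < e -> nbhs x [set y | d x y < e].
Proof. by move=> e0; apply/(dT.2 _ _); exists e. Qed.

Lemma metric_ball_open x e : open [set y | d x y < e].
Proof.
rewrite openE => y /= xy; apply/(dT.2 _ _); exists (e - d x y).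
  by rewrite subr_gt0.
by move=> z /=; have := dD x y z; lra.
Qed.

Lemma metric_ballP x A :
  nbhs x A -> exists2 e : R, 0 < e & forall y, d x y < e -> A y.
Proof. by move=> /(dT.2 _ _)[e e0 eA]; exists e. Qed.

Lemma invS_lt (e : R) : 0 < e -> exists n : nat, n.+1%:R^-1 < e.
Proof. by move=> /ltr_add_invr[n]; rewrite add0r; exists n. Qed.

Lemma invS_gt0 (n : nat) : 0 < n.+1%:R^-1 :> R.
Proof. by rewrite invr_gt0 ltr0n. Qed.

Lemma invS_le (m n : nat) : (m <= n)%N -> n.+1%:R^-1 <= m.+1%:R^-1 :> R.
Proof. by move=> mn; rewrite lef_pV2 ?posrE ?ltr0n// ler_nat ltnS. Qed.

(** The point x0 only provides a default value for the enumeration. *)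
Lemma separable_seq (x0 : T) : separable T ->
  exists q : nat -> T, forall x (e : R), 0 < e -> exists n, d (q n) x < e.
Proof.
move=> [D /countable_injP[f fI] dD'].
pose q n := if pselect (exists2 x, D x & f x = n) is left H
            then projT1 (cid2 H) else x0.
exists q => x e e0.
have [||y [/= xy Dy]] := dD' [set y | d x y < e].
- by exists x => /=; rewrite d0.
- exact: metric_ball_open.
exists (f y); rewrite /q; case: pselect => [H|[]]; last by exists y.
case: cid2 => z Dz /= /fI ->; rewrite ?inE//.
by rewrite dC.
Qed.

Lemma metric_countable_base (x0 : T) : separable T ->
  exists b : nat -> set T, countable_base b.
Proof.
move=> /(separable_seq x0)[q qP].
exists (fun m => if @unpickle (nat * nat)%type m is Some p
                 then [set y | d (q p.1) y < p.2.+1%:R^-1] else set0).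
split=> [m|x A /metric_ballP[e e0 eA]].
  by case: unpickle => [p|]; [exact: metric_ball_open|exact: open0].
have [n nx] : exists n, n.+1%:R^-1 < e / 2 by apply: invS_lt; lra.
have [k kx] := qP x _ (invS_gt0 n).
exists (pickle (k, n)); rewrite pickleK //= => y /= ky; apply: eA.
have := dD x (q k) y; rewrite (dC x (q k)).
by move: kx nx ky; move: (_^-1) => r; lra.
Qed.

End metric_theory.

Section generic_continuity.
Context {X Y : topologicalType}.
Implicit Types f : X -> Y.

Definition continuous_on (C : set X) f :=
  forall x V, C x -> nbhs (f x) V ->
    exists2 Q, nbhs x Q & forall x', Q x' -> C x' -> V (f x').

Lemma continuous_on_sub C D f :
  D `<=` C -> continuous_on C f -> continuous_on D f.
Proof.
move=> DC fC x V /DC Cx /(fC _ _ Cx)[Q xQ QV].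
by exists Q => // x' Qx' /DC; exact: QV.
Qed.

Lemma continuous_on_comp (Z : topologicalType) (p : Z -> X) C f :
  continuous p -> continuous_on C f ->
  forall z V, C (p z) -> nbhs (f (p z)) V ->
    exists2 Q, nbhs z Q & forall z', Q z' -> C (p z') -> V (f (p z')).
Proof.
move=> pc fC z V Cz /(fC _ _ Cz)[Q xQ QV]; exists (p @^-1` Q); first exact: pc.
by move=> z' Qz' Cz'; exact: QV.
Qed.

(** Remove the countably many meager symmetric differences between preimages of
    basic open sets and open sets. *)
Lemma baire_measurable_continuous_on (b : nat -> set Y) f :
  countable_base b -> baire_measurable f ->
  exists2 C, comeager C & continuous_on C f.
Proof.
move=> [ob bb] mf.
pose U n := projT1 (cid2 (mf _ (ob n))).
have oU n : open (U n) by rewrite /U; case: cid2.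
have mU n : meager (((f @^-1` b n) `\` U n) `|` (U n `\` (f @^-1` b n))).
  by rewrite /U; case: cid2.
exists (~` \bigcup_n (((f @^-1` b n) `\` U n) `|` (U n `\` (f @^-1` b n)))).
  by rewrite /comeager setCK; exact: meager_bigcup.
move=> x V Cx /bb[n bn bV]; exists (U n).
  apply: open_nbhs_nbhs; split; first exact: oU.
  by apply: contrapT => nU; apply: Cx; exists n => //; left.
move=> x' Ux' Cx'; apply: bV; apply: contrapT => nb; apply: Cx'.
by exists n => //; right.
Qed.

End generic_continuity.

(** * Generic uniformization *)

Section uniformization.
Context {R : realType} {Z W : topologicalType}.
Context (b : nat -> set Z) (d : W -> W -> R) (q : nat -> W).
Hypothesis b_base : countable_base b.
Hypothesis dW : compatible_metric d.
Hypothesis d_complete : complete_metric d.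
Hypothesis q_dense : forall x (e : R), 0 < e -> exists n, d (q n) x < e.
Context (C : set Z) (P : Z -> W -> Prop).
Hypothesis P_closed : forall z w, C z ->
  (forall Q (e : R), nbhs z Q -> 0 < e ->
    exists z' w', [/\ Q z', C z', d w' w < e & P z' w']) -> P z w.

Definition witnessed (N : set W) := [set z | C z /\ exists2 w, N w & P z w].

(** The nodes of a Souslin scheme: N is cut by a ball around q i of radius
    1/(k+1) at the k-th choice i.  The most recent choice is at the head of
    the list. *)
Fixpoint refine (N : set W) (s : seq nat) : set W :=
  if s is i :: s' then
    refine N s' `&` [set w | d (q i) w < (size s').+1%:R^-1]
  else N.

Let d0 x : d x x = 0. Proof. by have [[]] := dW. Qed.
Let dC x y : d x y = d y x. Proof. by have [[]] := dW. Qed.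
Let dD x y z : d x z <= d x y + d y z. Proof. by have [[]] := dW. Qed.

(** A closed relation P has actual witnesses above generic points of the thick
    part of its projection.  At a generic point z the thick parts of the
    projections of the nodes split at every level by [thick_part_split], so
    there is a branch of nodes whose projections are all thick near z.  The
    centers along the branch converge to some w, the pair (z,w) is approximated
    by points of P, and P is closed. *)
Lemma generic_uniformization N :
  meager (thick_part (witnessed N) `\`
    [set z | C z -> exists2 w, P z w &
       forall e : R, 0 < e -> exists2 w', N w' & d w' w < e]).
Proof.
pose A s := witnessed (refine N s).
have Asplit s : A s `<=` \bigcup_i A (i :: s).
  move=> z [Cz [w Nw Pw]]; have [i iw] := q_dense w (invS_gt0 (size s)).
  by exists i => //; split=> //; exists w.
pose M := \bigcup_s (thick_part (A s) `\` \bigcup_i thick_part (A (i :: s))).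
have mM : meager M.
  apply: meager_bigcup => s; apply: meager_nowhere_dense.
  exact: thick_part_split b_base (Asplit s).
apply: meager_sub mM => z [Az nE]; apply: contrapT => nM; apply: nE => Cz.
have step s : thick_part (A s) z -> exists i, thick_part (A (i :: s)) z.
  move=> sz; apply: contrapT => /forallNP ni; apply: nM.
  by exists s => //; split=> // -[i _ /ni].
have [u [u0 uS]] : exists u : nat -> seq nat, u 0%N = [::] /\
    forall n, thick_part (A (u n)) z /\ exists i, u n.+1 = i :: u n.
  pose next s := if pselect (exists i, thick_part (A (i :: s)) z) is left H
                 then projT1 (cid H) else 0%N.
  have nextP s : thick_part (A s) z -> thick_part (A (next s :: s)) z.
    by move=> /step H; rewrite /next; case: pselect => // H'; case: cid.
  exists (fun n => iter n (fun s => next s :: s) [::]); split=> // n.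
  split; last by exists (next (iter n (fun s => next s :: s) [::])).
  by elim: n => //= n; exact: nextP.
have size_u n : size (u n) = n.
  by elim: n => [|n IH]; [rewrite u0|have [_ [i ->]] := uS n; rewrite /= IH].
pose c n := q (head 0%N (u n.+1)).
have ref_c n w : refine N (u n) w -> forall m, (m < n)%N ->
    d (c m) w < m.+1%:R^-1.
  elim: n => // n IH; have [_ [i E]] := uS n; rewrite E /= => -[/IH H iw] m.
  rewrite ltnS leq_eqVlt => /orP[/eqP ->|/H //].
  by rewrite /c E /= -[X in X.+1%:R](size_u n).
have ref_N n w : refine N (u n) w -> N w.
  by elim: n => [|n IH]; rewrite ?u0//; have [_ [i ->]] := uS n => -[/IH].
have approx n Q : nbhs z Q -> exists z' w', [/\ Q z', C z', N w', P z' w' &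
    forall m, (m < n)%N -> d (c m) w' < m.+1%:R^-1].
  move=> zQ; have [zu _] := uS n.
  have [z' [Cz' [w' rw' Pw']] Qz'] := thick_part_adherent zu zQ.
  by exists z', w'; split=> //; [exact: ref_N rw'|exact: ref_c].
have [e e0|w cw] := d_complete (u := c).
  have [n ne] : exists n, n.+1%:R^-1 < e / 2 by apply: invS_lt; lra.
  exists n => k l nk nl.
  have [z' [w' [_ _ _ _ H]]] := approx (maxn k l).+1 _ filterT.
  have Hk := H k (leq_maxl _ _); have Hl := H l (leq_maxr _ _).
  have := dD (c k) w' (c l); rewrite (dC w' (c l)).
  have := @invS_le R _ _ nk; have := @invS_le R _ _ nl.
  move: Hk Hl ne; move: (n.+1%:R^-1) (k.+1%:R^-1) (l.+1%:R^-1) => r1 r2 r3.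
  lra.
have close Q e : nbhs z Q -> 0 < e ->
    exists z' w', [/\ Q z', C z', N w', P z' w' & d w' w < e].
  move=> zQ e0.
  have [n ne] : exists n, n.+1%:R^-1 < e / 2 by apply: invS_lt; lra.
  have [m mP] := cw (e / 2) ltac:(lra).
  have [z' [w' [Qz' Cz' Nw' Pw' H]]] := approx (maxn n m).+1 _ zQ.
  exists z', w'; split=> //.
  have H1 := H (maxn n m) (leqnn _); have H2 := mP _ (leq_maxr n m).
  have := dD w' (c (maxn n m)) w; rewrite (dC w' (c _)).
  have := @invS_le R _ _ (leq_maxl n m).
  move: H1 H2 ne; move: (n.+1%:R^-1) ((maxn n m).+1%:R^-1) => r1 r2.
  lra.
exists w.
  apply: P_closed => // Q e zQ e0.
  by have [z' [w' [? ? ? ? ?]]] := close Q e zQ e0; exists z', w'.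
move=> e e0; have [z' [w' [? ? ? ? ?]]] := close _ _ filterT e0.
by exists w'.
Qed.

End uniformization.

(** * Two-sided invariant metrics *)

Section tsi.
Context {R : realType} {H : topologicalGroupType} (d : H -> H -> R).
Hypothesis dH : compatible_metric d.
Hypothesis d_inv : forall g x y : H,
  d (g * x)%g (g * y)%g = d x y /\ d (x * g)%g (y * g)%g = d x y.

Let d0 x : d x x = 0. Proof. by have [[]] := dH. Qed.
Let dC x y : d x y = d y x. Proof. by have [[]] := dH. Qed.
Let dD x y z : d x z <= d x y + d y z. Proof. by have [[]] := dH. Qed.
Let dl g x y : d (g * x)%g (g * y)%g = d x y.
Proof. exact: (d_inv _ _ _).1. Qed.
Let dr g x y : d (x * g)%g (y * g)%g = d x y.
Proof. exact: (d_inv _ _ _).2. Qed.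

(** A Cauchy sequence u has an ideal limit in the completion of H for d.  A
    Polish group meets every translate of itself in its completion, because
    both are dense G_delta sets; the proof below unfolds the category argument
    for the translate by that limit.  It builds a sequence p j in H such that
    p (2i+1) = u_n (p (2i)) with n growing, and such that the p j of each
    parity are Cauchy for dc.  If these converge to a and b, then u converges
    to b a^-1. *)
Lemma tsi_complete (dc : H -> H -> R) :
  compatible_metric dc -> complete_metric dc -> complete_metric d.
Proof.
move=> dcH dc_complete u uC.
pose tail n (r : R) :=
  forall k l, (n <= k)%N -> (n <= l)%N -> d (u k) (u l) < r.
pose good a r (j : nat) := forall y, d a y < r -> dc a y < j.+1%:R^-1.
have goodP a j (e : R) : 0 < e -> exists r, [/\ 0 < r, r <= e & good a r j].
  move=> e0.
  have [r r0 rP] := metric_ballP dH (nbhs_metric_ball dcH a (invS_gt0 j)).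
  exists (Num.min r e).
  split; [by rewrite lt_min r0|by rewrite ge_min lexx orbT|].
  by move=> y; rewrite lt_min => /andP[+ _]; exact: rP.
have tailP n (r : R) : 0 < r -> exists2 m, (n <= m)%N & tail m r.
  move=> /uC[m mP]; exists (maxn n m); first exact: leq_maxl.
  by move=> k l; rewrite !geq_max => /andP[_ ?] /andP[_ ?]; exact: mP.
(* Even steps multiply by a term of u and odd steps by the inverse of one,
   so that p (j+2) is d-close to p j. *)
pose s (j : nat) (h : H) := if odd j then (h^-1)%g else h.
have ss j x y p : d (s j.+1 x * (s j y * p))%g p = d x y.
  rewrite /s /=; case: (odd j) => /=.
    by rewrite -{2}[p](mulVKg y) mulgA [in X in d _ X]mulgA; rewrite dr.
  by rewrite -(dl x) mulVKg dr dC.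
(* The state (p, r, n) consists of the current point, a radius such that the
   d-ball of radius r around p is dc-small, and the last index used in u. *)
have [f [fS1 fS2 fS3]] : exists f : nat -> H * R * nat, [/\
    forall j, 0 < (f j).1.2 /\ good (f j).1.1 (f j).1.2 j,
    forall j, (f j.+1).1.2 <= (f j).1.2 / 4 &
    forall j, [/\ ((f j).2 < (f j.+1).2)%N, tail (f j.+1).2 ((f j).1.2 / 4) &
      (f j.+1).1.1 = (s j (u (f j.+1).2) * (f j).1.1)%g]].
  have step j (p : H * R * nat) : exists p' : H * R * nat, 0 < p.1.2 ->
      [/\ 0 < p'.1.2, good p'.1.1 p'.1.2 j.+1, p'.1.2 <= p.1.2 / 4 &
      [/\ (p.2 < p'.2)%N, tail p'.2 (p.1.2 / 4) &
      p'.1.1 = (s j (u p'.2) * p.1.1)%g]].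
    have [p0|] := pselect (0 < p.1.2); last by exists p.
    have p4 : 0 < p.1.2 / 4 by lra.
    have [m pm mt] := tailP p.2.+1 _ p4.
    have [r [r0 re rg]] := goodP (s j (u m) * p.1.1)%g j.+1 _ p4.
    by exists ((s j (u m) * p.1.1)%g, r, m).
  have [r0 [r00 _ r0g]] := goodP 1%g 0%N 1 ltr01.
  pose f := fix f j := if j is j'.+1 then projT1 (cid (step j' (f j')))
                       else (1%g, r0, 0%N).
  have f0 j : 0 < (f j).1.2 /\ good (f j).1.1 (f j).1.2 j.
    elim: j => [//|j [IH _]] /=.
    by case: (cid (step j (f j))) => p' /= /(_ IH)[].
  exists f; split=> // j; have [fj _] := f0 j.
    by rewrite /=; case: (cid (step j (f j))) => p' /= /(_ fj)[].
  by rewrite /=; case: (cid (step j (f j))) => p' /= /(_ fj)[].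
pose p j := (f j).1.1; pose r j := (f j).1.2; pose n j := (f j).2.
have r0 j : 0 < r j by have [] := fS1 j.
have p2 j : d (p j) (p j.+2) < r j / 4.
  have [_ t E] := fS3 j; have [n12 _ E'] := fS3 j.+1.
  by rewrite dC /p E' E ss; apply: t => //; exact: ltnW.
have pd i : forall j, d (p j) (p (i.*2 + j)%N) <= r j / 2.
  elim: i => [|i IH] j; first by rewrite d0; have := r0 j; lra.
  have := IH j.+2; rewrite doubleS !addSn !addnS.
  have := fS2 j; have := fS2 j.+1; have := p2 j.
  have := dD (p j) (p j.+2) (p (i.*2 + j).+2); have := r0 j.
  rewrite -!/(r _); lra.
have pc i j : dc (p j) (p (i.*2 + j)%N) < j.+1%:R^-1.
  have [_] := fS1 j; apply; have := pd i j; have := r0 j.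
  by rewrite -/(r j) -/(p j); lra.
have lim k : exists l, forall e : R, 0 < e -> exists N, forall i, (N <= i)%N ->
    dc (p (i.*2 + k)%N) l < e.
  apply: (dc_complete (fun i => p (i.*2 + k)%N)) => e e0.
  have [N NE] := invS_lt e0.
  have H1 i j : (N <= i)%N -> (i <= j)%N ->
      dc (p (i.*2 + k)%N) (p (j.*2 + k)%N) < e.
    move=> Ni ij; rewrite -(subnK ij) doubleD -addnA.
    apply: lt_trans (pc _ _) _; apply: le_lt_trans NE; apply: invS_le.
    by rewrite (leq_trans Ni)// -addnn -addnA leq_addr.
  exists N => i j Ni Nj; have [ij|/ltnW ji] := leqP i j; first exact: H1.
  by have [[_ _ -> _] _] := dcH; exact: H1.
have [a aP] := lim 0%N; have [b bP] := lim 1%N.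
exists (b * a^-1)%g => e e0.
have ball_nbhs : nbhs (b * a^-1)%g [set y | d (b * a^-1)%g y < e / 2].
  by apply: nbhs_metric_ball => //; lra.
have [[B A] /= [bB aA] BA] := @mulg_continuous H (b, a^-1)%g _ ball_nbhs.
have {}aA := @invg_continuous H a _ aA.
have [e1 e10 e1B] := metric_ballP dcH bB.
have [e2 e20 e2A] := metric_ballP dcH aA.
have [N1 N1P] := bP _ e10; have [N2 N2P] := aP _ e20.
have [N3 N3P] := uC (e / 2) ltac:(lra).
pose i := maxn (maxn N1 N2) N3.
have n_ge j : (j <= n j)%N.
  by elim: j => // j IH; have [+ _ _] := fS3 j; exact: leq_ltn_trans.
have ui : u (n (i.*2 + 1)%N) = (p (i.*2 + 1)%N * (p (i.*2 + 0)%N)^-1)%g.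
  rewrite addn1 addn0; have [_ _ E] := fS3 i.*2.
  by rewrite /p E /s odd_double mulgK.
exists N3 => m N3m.
have d1 : d (u m) (u (n (i.*2 + 1)%N)) < e / 2.
  apply: N3P => //; apply: leq_trans (n_ge _).
  by rewrite -addnn -addnA (leq_trans _ (leq_addr _ _))// leq_maxr.
have d2 : d (b * a^-1)%g (u (n (i.*2 + 1)%N)) < e / 2.
  rewrite ui; apply: (BA (_, _)); split=> /=; [apply: e1B|apply: e2A].
    have [[_ _ -> _] _] := dcH; apply: N1P.
    by rewrite /i -maxnA leq_maxl.
  have [[_ _ -> _] _] := dcH; apply: N2P.
  by rewrite /i (leq_trans (leq_maxr N1 _))// leq_maxl.
by have := dD (u m) (u (n (i.*2 + 1)%N)) (b * a^-1)%g;
  rewrite (dC (u (n _)) (b * a^-1)%g); lra.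
Qed.

End tsi.

(** * The orbit pseudometric of a TSI action *)

Section near_orbit.
Context {R : realType} {H : topologicalGroupType} {Y : topologicalType}.
Context (d : H -> H -> R) (act : H -> Y -> Y).
Hypothesis dH : compatible_metric d.
Hypothesis d_inv : forall g x y : H,
  d (g * x)%g (g * y)%g = d x y /\ d (x * g)%g (y * g)%g = d x y.
Hypothesis act_cont : continuous_action act.

Definition near_orbit (e : R) (y y' : Y) :=
  exists2 w : H, d 1%g w <= e & y' = act w y.

Let d0 x : d x x = 0. Proof. by have [[]] := dH. Qed.
Let dC x y : d x y = d y x. Proof. by have [[]] := dH. Qed.
Let dD x y z : d x z <= d x y + d y z. Proof. by have [[]] := dH. Qed.
Let dl g x y : d (g * x)%g (g * y)%g = d x y.
Proof. exact: (d_inv _ _ _).1. Qed.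
Let dr g x y : d (x * g)%g (y * g)%g = d x y.
Proof. exact: (d_inv _ _ _).2. Qed.
Let act1 y : act 1%g y = y. Proof. by have [] := act_cont. Qed.
Let actM g h y : act (g * h)%g y = act g (act h y).
Proof. by have [] := act_cont. Qed.
Let actK g y : act (g^-1)%g (act g y) = y.
Proof. by rewrite -actM mulVg act1. Qed.

Lemma near_orbit_sym e y y' : near_orbit e y y' -> near_orbit e y' y.
Proof.
move=> [w w_e ->]; exists (w^-1)%g; last by rewrite actK.
by rewrite -(dl w) mulg1 mulgV dC.
Qed.

Lemma near_orbit_trans e1 e2 y1 y2 y3 :
  near_orbit e1 y1 y2 -> near_orbit e2 y2 y3 -> near_orbit (e1 + e2) y1 y3.
Proof.
move=> [w w_e ->] [v v_e ->]; exists (v * w)%g; last by rewrite actM.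
by have := dD 1%g v (v * w)%g; rewrite -{3}[v]mulg1 dl; lra.
Qed.

(** Conjugation by h preserves the distance to 1. *)
Lemma near_orbit_act e h y y' :
  near_orbit e (act h y) (act h y') <-> near_orbit e y y'.
Proof.
have dJ g w : d 1%g (g * w * g^-1)%g = d 1%g w.
  by rewrite -{1}(mulgV g) dr -{1}[g]mulg1 dl.
split=> [[w w_e E]|[w w_e ->]].
  exists (h^-1 * w * h)%g; first by rewrite -{2}[h]invgK dJ.
  by rewrite !actM -E actK.
by exists (h * w * h^-1)%g; rewrite ?dJ// !actM actK.
Qed.

(** * Local constancy of cocycles *)

Section cocycle.
Context {dY : Y -> Y -> R} {Z : topologicalType} (b : nat -> set Z).
Hypothesis dY_compat : compatible_metric dY.
Hypothesis d_complete : complete_metric d.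
Hypothesis H_sep : separable H.
Hypothesis b_base : countable_base b.

(** If psi z and w (phi z) were different, then by continuity they would stay
    apart at all points of C x H near (z,w). *)
Lemma translation_closed (C : set Z) (phi psi : Z -> Y) :
  continuous_on C phi -> continuous_on C psi ->
  forall z w, C z ->
    (forall Q (e : R), nbhs z Q -> 0 < e ->
      exists z' w', [/\ Q z', C z', d w' w < e & psi z' = act w' (phi z')]) ->
    psi z = act w (phi z).
Proof.
move=> phiC psiC z w Cz approx; apply: contrapT => /(metric_gt0 dY_compat).
set t := dY _ _ => t0; have t2 : 0 < t / 2 by lra.
have [Q1 zQ1 Q1P] := psiC _ _ Cz (nbhs_metric_ball dY_compat (psi z) t2).
have [_ _ ac] := act_cont.
have [[A V] /= [wA zV] AV] :=
  ac (w, phi z) _ (nbhs_metric_ball dY_compat (act w (phi z)) t2).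
have [e e0 eA] := metric_ballP dH wA.
have [Q2 zQ2 Q2P] := phiC _ _ Cz zV.
have [z' [w' [[Q1z Q2z] Cz' w'w E]]] := approx _ _ (filterI zQ1 zQ2) e0.
have /= H1 := Q1P _ Q1z Cz'.
have /= H2 : dY (act w (phi z)) (act w' (phi z')) < t / 2.
  by apply: (AV (_, _)); split=> /=; [apply: eA; rewrite dC|exact: Q2P].
have [[_ _ dYC dYD] _] := dY_compat.
have := dYD (psi z) (psi z') (act w (phi z)).
by rewrite {2}E (dYC (act w' _)) -/t; lra.
Qed.

(** Countably many d-balls N i cover H, so for some i the set of z that admit a
    witness w in N i is thick in an open set.  Generic uniformization makes it
    comeager there, with w in the closure of N i. *)
Lemma locally_constant_cocycle (C U : set Z) (phi psi : Z -> Y) (e : R) :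
  comeager C -> continuous_on C phi -> continuous_on C psi ->
  (forall z, C z -> exists w, psi z = act w (phi z)) ->
  open U -> ~ meager U -> 0 < e ->
  exists h, exists V, exists D, [/\ [/\ open V, V !=set0 & V `<=` U],
    comeager D & forall z, V z -> D z -> near_orbit e (act h (phi z)) (psi z)].
Proof.
move=> cC phiC psiC phi_psi oU nmU e0.
have [q qP] := separable_seq dH 1%g H_sep.
pose N i := [set w | d (q i) w < e].
pose P z w := psi z = act w (phi z).
have [i nmi] : exists i, ~ meager (witnessed C P (N i) `&` U).
  apply: contrapT => /forallNP mi.
  apply: (nonmeager_comeager nmU cC).
  apply: meager_sub (meager_bigcup (fun i => contrapT (mi i))).
  move=> z [Uz Cz]; have [w Pw] := phi_psi z Cz.
  by have [i iw] := qP w e e0; exists i => //; split=> //; split=> //; exists w.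
have [V [oV V0 VU tV]] := nonmeager_thick b_base oU nmi.
have mU := generic_uniformization b_base dH d_complete qP
  (translation_closed phiC psiC) (N i).
exists (q i), V, (C `&` ~` (thick_part (witnessed C P (N i)) `\` [set z | C z ->
  exists2 w, P z w & forall e, 0 < e -> exists2 w', N i w' & d w' w < e])).
split=> //; first by apply: comeagerI => //; rewrite /comeager setCK.
move=> z Vz [Cz nz].
have [w Pw w_e] : exists2 w, P z w &
    forall e, 0 < e -> exists2 w', N i w' & d w' w < e.
  apply: contrapT => nE; apply: nz; split; first by exists V.
  by move=> /(_ Cz).
have qw : d (q i) w <= e.
  apply/ler_addgt0Pr => t t0; have [w' /= w'N w'w] := w_e t t0.
  by have := dD (q i) w' w; rewrite /N /= in w'N; lra.
exists (w * (q i)^-1)%g; last by rewrite actM actK.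
by rewrite -(dr (q i)) mul1g mulgVK.
Qed.

(** * Limits in an orbit *)

(** The products of the translations from y n to y (n+1) form a Cauchy sequence
    in H; its limit moves y 0 to l. *)
Lemma orbit_limit (y : nat -> Y) (l : Y) :
  (forall n, near_orbit (2 ^- n) (y n) (y n.+1)) ->
  (forall A, nbhs l A -> exists N, forall n, (N <= n)%N -> A (y n)) ->
  exists h, act h (y 0%N) = l.
Proof.
move=> near_y y_l.
pose w n := projT1 (cid2 (near_y n)).
have w_small n : d 1%g (w n) <= 2 ^- n by rewrite /w; case: cid2.
have wE n : y n.+1 = act (w n) (y n) by rewrite /w; case: cid2.
pose h := fix h n := if n is n'.+1 then (w n' * h n')%g else 1%g.
have hE n : act (h n) (y 0%N) = y n.
  by elim: n => [|n IH]; [exact: act1|rewrite /= actM IH wE].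
have p0 n : 0 < 2 ^- n :> R by rewrite invr_gt0 exprn_gt0.
have pS n : 2 ^- n = 2 * 2 ^- n.+1 :> R.
  by rewrite exprS invfM mulrA mulfV// mul1r.
have hS n : d (h n) (h n.+1) <= 2 ^- n by rewrite /= -{1}[h n]mul1g dr.
(* The telescoping form of the bound makes the induction go through. *)
have hd k n : d (h n) (h (k + n)%N) <= 2 * 2 ^- n - 2 * 2 ^- (k + n)%N.
  elim: k => [|k IH]; first by rewrite d0; lra.
  have := dD (h n) (h (k + n)%N) (h (k + n).+1); have := hS (k + n)%N.
  by rewrite addSn; have := pS (k + n)%N; move: IH; lra.
have small (e : R) : 0 < e -> exists N : nat, 2 * 2 ^- N < e.
  move=> e0; have [N NE] := @invS_lt R (e / 2) ltac:(lra).
  exists N; suff : 2 ^- N <= N.+1%:R^-1 :> R.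
    by move: NE; move: (N.+1%:R^-1) (2 ^- N) => r1 r2; lra.
  by rewrite lef_pV2 ?posrE ?exprn_gt0// -natrX ler_nat ltn_expl.
have hd' N m n : (N <= m)%N -> (m <= n)%N -> d (h m) (h n) < 2 * 2 ^- N.
  move=> Nm mn; rewrite -(subnK mn).
  have := hd (n - m)%N m; have := p0 (n - m + m)%N.
  have : 2 ^- m <= 2 ^- N :> R.
    by rewrite lef_pV2 ?posrE ?exprn_gt0// ler_eXn2l// ltr1n.
  lra.
have [e e0|hl hlP] := d_complete (u := h).
  have [N Ne] := small e e0; exists N => m n Nm Nn.
  apply: lt_trans Ne; have [mn|/ltnW nm] := leqP m n; first exact: hd'.
  by rewrite dC; exact: hd'.
exists hl; apply: contrapT => /(metric_gt0 dY_compat).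
set t := dY _ _ => t0; have t2 : 0 < t / 2 by lra.
have [N1 N1P] := y_l _ (nbhs_metric_ball dY_compat l t2).
have [_ _ ac] := act_cont.
have [[A V] /= [hA yV] AV] :=
  ac (hl, y 0%N) _ (nbhs_metric_ball dY_compat (act hl (y 0%N)) t2).
have [e e0 eA] := metric_ballP dH hA.
have [N2 N2P] := hlP e e0.
pose n := maxn N1 N2.
have /= H1 := N1P n (leq_maxl _ _).
have /= H2 : dY (act hl (y 0%N)) (act (h n) (y 0%N)) < t / 2.
  apply: (AV (_, _)); split=> /=; last exact: nbhs_singleton yV.
  by apply: eA; rewrite dC; apply: N2P; rewrite leq_maxr.
have [[_ _ dYC dYD] _] := dY_compat.
have := dYD (act hl (y 0%N)) (y n) l; rewrite -/t (dYC (y n)).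
by move: H2; rewrite hE; lra.
Qed.

End cocycle.
End near_orbit.

(** * Shifts and finite bit flips on the space of the jump *)

Section continuity.
Context {S T : topologicalType}.
Context {c : nat -> S -> S -> Prop} {d : nat -> T -> T -> Prop}.
Hypotheses (cS : cylinders (T := S) c) (cT : cylinders (T := T) d).

Lemma cyl_continuous (f : S -> T) :
  (forall x n, exists m, forall y, c m x y -> d n (f x) (f y)) -> continuous f.
Proof.
move=> fP x A /(cyl_nbhs cT)[n nA]; have [m mP] := fP x n.
by apply/(cyl_nbhs cS); exists m => y /mP; exact: nA.
Qed.

End continuity.

Lemma comeager_preimage_homeo (S T : topologicalType) (p : S -> T) (q : T -> S)
    (A : set T) :
  continuous p -> continuous q -> cancel p q -> cancel q p ->
  comeager A -> comeager (p @^-1` A).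
Proof.
move=> pc qc pK qK; apply: comeager_preimage => // U oU [x Ux].
exists (q @^-1` U); split.
- by apply: open_comp => // z _; exact: qc.
- by exists (p x); rewrite /= pK.
- by move=> y Uy; exists (q y).
Qed.

Definition cantor_seqs : topologicalType := {ptws Zgrp -> cantor_space}.

(** A natural number codes the finite set of the positions of its binary
    digits 1, so that bitwise exclusive or is the group law. *)
Definition bit_flips : topologicalType := {ptws Zgrp -> nat}.

Definition rank (i : Zgrp) : nat := `|(i : int)|%N.

Definition agree (n : nat) (x y : cantor_seqs) :=
  forall i, (rank i < n)%N -> forall m, (m < n)%N -> x i m = y i m.

Definition flips_agree (n : nat) (g h : bit_flips) :=
  forall i, (rank i < n)%N -> g i = h i.

Lemma rank_enum : exists s : nat -> seq Zgrp,
  forall n i, (rank i < n)%N -> i \in s n.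
Proof.
exists (fun n => [seq (k%:Z : Zgrp) | k <- iota 0 n] ++
                 [seq (- k%:Z : Zgrp) | k <- iota 0 n]).
move=> n i ri; rewrite mem_cat; apply/orP.
have [i0|i0] := leP 0 (i : int); [left|right]; apply/mapP; exists (rank i).
- by rewrite mem_iota.
- by rewrite /rank; lia.
- by rewrite mem_iota.
- by rewrite /rank; lia.
Qed.

Lemma cylinders_cantor_seqs : cylinders agree.
Proof.
have cbool : cylinders (T := bool) (fun=> eq).
  apply: (@cylinders_discrete _ nat_of_bool) => [[] []//|x A].
  by rewrite nbhs_principalE; split=> /principal_filterP.
have ccantor : cylinders (T := cantor_space)
    (fun n x y => forall m, (m < n)%N -> x m = y m).
  apply: (@cylinders_ptws nat bool _ id (iota 0) _ cbool).
  by move=> n i; rewrite mem_iota.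
have [s sP] := rank_enum; exact: cylinders_ptws sP ccantor.
Qed.

Lemma cylinders_bit_flips : cylinders flips_agree.
Proof.
have cnat : cylinders (T := nat) (fun=> eq).
  apply: (@cylinders_discrete _ id) => [//|x A].
  by rewrite nbhs_principalE; split=> /principal_filterP.
have [s sP] := rank_enum; exact: cylinders_ptws sP cnat.
Qed.

Definition flip (g : bit_flips) (x : cantor_seqs) : cantor_seqs :=
  fun i m => x i m (+) Nat.testbit (g i) m.

Definition flip_mul (g h : bit_flips) : bit_flips :=
  fun i => Nat.lxor (g i) (h i).

Definition zshift (t : Zgrp) (x : cantor_seqs) : cantor_seqs :=
  fun i => x (t^-1 * i)%g.

Lemma flip_flip g h x : flip h (flip g x) = flip (flip_mul g h) x.
Proof.
apply/funext => i; apply/funext => m; rewrite /flip PeanoNat.Nat.lxor_spec.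
by case: (x i m); case: Nat.testbit; case: Nat.testbit.
Qed.

Lemma flip_mulC g h : flip_mul g h = flip_mul h g.
Proof. by apply/funext => i; exact: PeanoNat.Nat.lxor_comm. Qed.

Lemma flip_mulK h g : flip_mul (flip_mul g h) h = g.
Proof.
apply/funext => i; rewrite /flip_mul PeanoNat.Nat.lxor_assoc.
by rewrite PeanoNat.Nat.lxor_nilpotent PeanoNat.Nat.lxor_0_r.
Qed.

Lemma flip_same g x i : g i = 0%N -> flip g x i = x i.
Proof.
by move=> gi; apply/funext => m; rewrite /flip gi PeanoNat.Nat.bits_0 addbF.
Qed.

Lemma flipK g : involutive (flip g).
Proof.
move=> x; rewrite flip_flip; apply/funext => i; apply: flip_same.
exact: PeanoNat.Nat.lxor_nilpotent.
Qed.

Lemma zshiftK t : cancel (zshift t) (zshift (t^-1)%g).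
Proof. by move=> x; apply/funext => i; rewrite /zshift mulVKg. Qed.

Lemma zshiftVK t : cancel (zshift (t^-1)%g) (zshift t).
Proof. by move=> x; apply/funext => i; rewrite /zshift mulKg. Qed.

Lemma zshift_flip t g x :
  zshift t (flip g x) = flip (fun i => g (t^-1 * i)%g) (zshift t x).
Proof. by []. Qed.

Lemma bits_code (s : nat -> bool) (n : nat) :
  exists a, forall m, Nat.testbit a m = (m < n)%N && s m.
Proof.
elim: n => [|n [a aP]]; first by exists 0%N => m; exact: PeanoNat.Nat.bits_0.
exists (if s n then PeanoNat.Nat.setbit a n else a) => m.
rewrite ltnS leq_eqVlt.
have [->|/eqP mn] := eqVneq m n.
  case sn: (s n); last by rewrite aP ltnn sn.
  by rewrite PeanoNat.Nat.setbit_eqb PeanoNat.Nat.eqb_refl.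
case sn: (s n); rewrite /= -?aP// PeanoNat.Nat.setbit_eqb.
by have /PeanoNat.Nat.eqb_neq -> := nesym mn.
Qed.

Lemma flip_dense n x y : exists g, agree n x (flip g y).
Proof.
pose g i := projT1 (cid (bits_code (fun m => x i m (+) y i m) n)).
exists g => i _ m mn; rewrite /flip /g; case: cid => a /= ->.
by rewrite mn /=; case: (x i m); case: (y i m).
Qed.

Lemma flip_agree n g x y : agree n x y -> agree n (flip g x) (flip g y).
Proof. by move=> xy i ri m mn; rewrite /flip xy. Qed.

Lemma flip_continuous :
  continuous (fun z : cantor_seqs * bit_flips => flip z.2 z.1).
Proof.
apply: cyl_continuous (cylinders_prod cylinders_cantor_seqs cylinders_bit_flips)
  cylinders_cantor_seqs _ _ => -[x g] n.
exists n => -[y h] /= [xy gh] i ri m mn.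
by rewrite /flip xy// gh.
Qed.

Lemma flip_continuousl g : continuous (flip g).
Proof.
apply: cyl_continuous cylinders_cantor_seqs cylinders_cantor_seqs _ _ => x n.
by exists n => y; exact: flip_agree.
Qed.

Lemma flip_continuousr x : continuous (flip^~ x).
Proof.
apply: cyl_continuous cylinders_bit_flips cylinders_cantor_seqs _ _ => g n.
by exists n => h gh i ri m mn; rewrite /flip gh.
Qed.

Lemma flip_mul_continuous h : continuous (flip_mul^~ h).
Proof.
apply: cyl_continuous cylinders_bit_flips cylinders_bit_flips _ _ => g n.
by exists n => k gk i ri; rewrite /flip_mul gk.
Qed.

Lemma rankM t i : (rank (t * i)%g <= rank t + rank i)%N.
Proof.
suff H (m n : int) : (absz (m + n)%R <= absz m + absz n)%N by exact: (H t i).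
by lia.
Qed.

Lemma rankV t : rank (t^-1)%g = rank t.
Proof. exact: (@abszN (t : int)). Qed.

Lemma zshift_continuous t : continuous (zshift t).
Proof.
apply: cyl_continuous cylinders_cantor_seqs cylinders_cantor_seqs _ _ => x n.
exists (rank t + n)%N => y xy i ri m mn; apply: xy.
  by apply: leq_ltn_trans (rankM _ _) _; rewrite rankV ltn_add2l.
by rewrite (leq_trans mn) ?leq_addl.
Qed.

(** Above a fixed flip g, the map is the homeomorphism [flip g]. *)
Lemma flip_open U : open U -> U !=set0 -> exists V,
  [/\ open V, V !=set0 &
      V `<=` (fun z : cantor_seqs * bit_flips => flip z.2 z.1) @` U].
Proof.
move=> oU [[x g] Uxg].
have [n nU] := open_cyl (cylinders_prod cylinders_cantor_seqs
  cylinders_bit_flips) oU Uxg.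
exists (flip g @^-1` agree n x); split.
- apply: open_comp; first by move=> z _; exact: flip_continuousl.
  exact: cyl_open cylinders_cantor_seqs _ _.
- exists (flip g x); rewrite /= flipK.
  exact: cyl_refl cylinders_cantor_seqs _ _.
- by move=> y xy; exists (flip g y, g); [apply: nU; split|rewrite /= flipK].
Qed.

(** Pull D back along the map that sends (x,g) to the flip of x by g, and take
    sections. *)
Lemma comeager_flip D : comeager D ->
  comeager [set x | comeager [set g | D (flip g x)]].
Proof.
move=> cD; have [b bb] := cyl_countable_base cylinders_bit_flips.
apply: (@kuratowski_ulam _ _ b bb [set z | D (flip z.2 z.1)]).
exact: comeager_preimage flip_continuous flip_open _ cD.
Qed.

(** The two windows of radius n are centered at -(k+n) and k+n; they are
    disjoint from each other and from the indices of rank below k. *)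
Lemma far_windows (k n : nat) : exists t t' : Zgrp, forall j,
  [/\ (rank (t * j)%g < n)%N -> (k <= rank j)%N,
      (rank (t' * j)%g < n)%N -> (k <= rank j)%N &
      (rank (t * j)%g < n)%N -> (n <= rank (t' * j)%g)%N].
Proof.
exists (Posz (k + n) : Zgrp), (- Posz (k + n) : Zgrp) => j.
suff H (t i : int) : t = Posz (k + n) ->
    [/\ (absz (t + i)%R < n)%N -> (k <= absz i)%N,
        (absz (- t + i)%R < n)%N -> (k <= absz i)%N &
        (absz (t + i)%R < n)%N -> (n <= absz (- t + i)%R)%N].
  exact: (H (Posz (k + n)) j erefl).
by move=> ->; split; lia.
Qed.

Lemma jump_zshift t x : jump (Gamma := Zgrp) E0 x (zshift t x).
Proof. by exists t => a; exists 0%N. Qed.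

Lemma jump_flip g x : jump (Gamma := Zgrp) E0 x (flip g x).
Proof.
exists 1%g => a; rewrite invg1 mul1g; exists (Nat.log2 (g a)).+1 => // m /= am.
rewrite /flip PeanoNat.Nat.bits_above_log2 ?addbF//.
exact/ssrnat.ltP.
Qed.

(** * Homomorphisms to a TSI action *)

Section homomorphism.
Context {R : realType} {H : topologicalGroupType} {Y : topologicalType}.
Context (d : H -> H -> R) (dY : Y -> Y -> R) (act : H -> Y -> Y).
Hypothesis dH : compatible_metric d.
Hypothesis d_inv : forall g x y : H,
  d (g * x)%g (g * y)%g = d x y /\ d (x * g)%g (y * g)%g = d x y.
Hypothesis d_complete : complete_metric d.
Hypothesis H_sep : separable H.
Hypothesis dY_compat : compatible_metric dY.
Hypothesis act_cont : continuous_action act.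
Context (f : cantor_seqs -> Y) (C : set cantor_seqs).
Hypothesis f_hom : homomorphism (jump (Gamma := Zgrp) E0) (orbit_rel act) f.
Hypothesis cC : comeager C.
Hypothesis f_cont : continuous_on C f.

Let close := near_orbit d act.
Let close_sym := near_orbit_sym dH d_inv act_cont.
Let close_trans := near_orbit_trans dH d_inv act_cont.
Let close_act := near_orbit_act d_inv act_cont.
Let cX := cylinders_cantor_seqs.
Let cG := cylinders_bit_flips.
Let cXG := cylinders_prod cX cG.

(** The cocycle from x to its flips is e-constant, with value h, on a box in the
    product of the space of sequences and the space of flips.  If v is the flip
    of u by k, a generic g in the box makes u flipped by g k and v flipped by g
    the same point; it is e-close to both h (f u) and h (f v). *)
Lemma orbit_continuity (e : R) : 0 < e ->
  exists n p D, comeager D /\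
    forall u g, D u -> D (flip g u) -> agree n p u -> agree n p (flip g u) ->
      (forall i, (rank i < n)%N -> g i = 0%N) ->
      close (e + e) (f u) (f (flip g u)).
Proof.
move=> e0; have [b bb] := cyl_countable_base cXG.
pose C' := [set z : cantor_seqs * bit_flips | C z.1 /\ C (flip z.2 z.1)].
have fst_cont : continuous (fun z : cantor_seqs * bit_flips => z.1).
  by move=> z; exact: cvg_fst.
have cC' : comeager C'.
  apply: comeagerI.
    apply: (comeager_preimage fst_cont _ cC) => U oU [z Uz].
    exists ((fun z => z.1) @` U); split=> //; first exact: fst_open.
    by exists z.1, z.
  exact: comeager_preimage flip_continuous flip_open _ cC.
have [||||||h [V [D [[oV [[p g0] Vp] _] cD DP]]]] :=
  @locally_constant_cocycle R H Y d act dH d_inv act_cont dY _ b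
    dY_compat d_complete H_sep bb C' setT (fun z => f z.1)
    (fun z => f (flip z.2 z.1)) e cC'.
- move=> z A [Cz _] /(continuous_on_comp fst_cont f_cont Cz)[Q zQ QP].
  by exists Q => // z' Qz' [Cz' _]; exact: QP.
- move=> z A [_ Cz] /(continuous_on_comp flip_continuous f_cont Cz)[Q zQ QP].
  by exists Q => // z' Qz' [_ Cz']; exact: QP.
- move=> z _; have [w wE] := f_hom (jump_flip z.2 z.1).
  by exists w.
- exact: openT.
- apply: (cyl_baire cXG); first exact: openT.
  by exists (point : cantor_seqs, point : bit_flips).
- exact: e0.
have [n nV] := open_cyl cXG oV Vp.
have [bG bbG] := cyl_countable_base cG.
exists n, p, [set x | comeager [set g | D (x, g)]]; split.
  exact: kuratowski_ulam bbG _ cD.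
move=> u k Du Dv pu pv k0.
have Du' : comeager [set g | D (u, flip_mul g k)].
  apply: (comeager_preimage_homeo (p := flip_mul^~ k) (q := flip_mul^~ k)
    _ _ _ _ Du).
  - exact: flip_mul_continuous.
  - exact: flip_mul_continuous.
  - exact: flip_mulK.
  - exact: flip_mulK.
have [g [Dug Dvg] g0g] := comeager_meets cG (comeagerI Du' Dv)
  (cyl_open cG n g0) (ex_intro _ g0 (cyl_refl cG n g0)).
have Vu : V (u, flip_mul g k).
  apply: nV; split=> //= i ri; rewrite /flip_mul k0//.
  by rewrite PeanoNat.Nat.lxor_0_r; exact: g0g.
have Vv : V (flip k u, g) by apply: nV.
have := DP _ Vu Dug; have := DP _ Vv Dvg.
rewrite /= flip_flip flip_mulC => /close_sym nv nu.
by apply/(close_act _ h); exact: close_trans nu nv.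
Qed.

(** The sets V are chosen inside U1, whose points are moved into the open set of
    [orbit_continuity] by both shifts t and t', and such that the cocycles of
    both shifts are generically e-constant on V.  Then u is joined to its flip
    by g through the flip z of u which agrees with u on the window of t and
    with flip g u on the window of t'. *)
Lemma locally_constant_on_flips (e : R) (U : set cantor_seqs) : 0 < e ->
  open U -> U !=set0 ->
  exists V D, [/\ [/\ open V, V !=set0 & V `<=` U], comeager D &
    forall u g, V u -> V (flip g u) -> D u -> D (flip g u) ->
      close (8 * e) (f u) (f (flip g u))].
Proof.
move=> e0 oU [p0 Up0].
have [n [p [D [cD DP]]]] := orbit_continuity e0.
have [k kU] := open_cyl cX oU Up0.
have [t [t' far]] := far_windows k n.
pose p1 : cantor_seqs := fun j => if (rank (t * j)%g < n)%N then p (t * j)%g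
  else if (rank (t' * j)%g < n)%N then p (t' * j)%g else p0 j.
pose U1 := U `&` ([set x | agree n p (zshift t x)] `&`
  [set x | agree n p (zshift t' x)]).
have oU1 : open U1.
  apply: openI => //; apply: openI; apply: open_comp => [z _|].
  - exact: zshift_continuous.
  - exact: cyl_open cX _ _.
  - exact: zshift_continuous.
  - exact: cyl_open cX _ _.
have U1p1 : U1 p1.
  split; last split.
  - apply: kU => j rj m mk; rewrite /p1; have [f1 f2 _] := far j.
    case: ifP => [/f1|_]; first by rewrite leqNgt rj.
    by case: ifP => [/f2|_ //]; rewrite leqNgt rj.
  - by move=> i ri m mk; rewrite /zshift /p1 mulVKg ri.
  - move=> i ri m mk; rewrite /zshift /p1 !mulVKg ri.
    have [_ _] := far (t'^-1 * i)%g; rewrite mulVKg.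
    by case: ifP => // _ /(_ isT); rewrite leqNgt ri.
have [b bb] := cyl_countable_base cX.
have cocycle s W : open W -> W !=set0 -> exists h V D, [/\
    [/\ open V, V !=set0 & V `<=` W], comeager D &
    forall z, V z -> D z -> close e (act h (f z)) (f (zshift s z))].
  move=> oW W0.
  have cCs : comeager (C `&` [set x | C (zshift s x)]).
    apply: comeagerI => //; apply: comeager_preimage_homeo cC.
    - exact: zshift_continuous.
    - exact: (@zshift_continuous (s^-1)%g).
    - exact: zshiftK.
    - exact: zshiftVK.
  apply: (@locally_constant_cocycle R H Y d act dH d_inv act_cont dY _ b
    dY_compat d_complete H_sep bb _ W f (f \o zshift s) e cCs) => //.
  - by apply: continuous_on_sub f_cont => x [].
  - move=> z A [_ Cz] /(continuous_on_comp (@zshift_continuous s) f_cont Cz).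
    by move=> [Q zQ QP]; exists Q => // z' Qz' [_ Cz']; exact: QP.
  - move=> z _; have [w wE] := f_hom (jump_zshift s z); by exists w.
  - exact: cyl_baire cX _ oW W0.
have [h [U2 [D2 [[oU2 U20 U21] cD2 D2P]]]] :=
  cocycle t U1 oU1 (ex_intro _ p1 U1p1).
have [h' [U3 [D3 [[oU3 [p3 Up3] U32] cD3 D3P]]]] := cocycle t' U2 oU2 U20.
have [l lU3] := open_cyl cX oU3 Up3.
pose D0 := (D2 `&` D3) `&` ([set x | D (zshift t x)] `&`
  [set x | D (zshift t' x)]).
have cD0 : comeager D0.
  apply: comeagerI; first exact: comeagerI.
  apply: comeagerI; apply: comeager_preimage_homeo cD.
  - exact: zshift_continuous.
  - exact: (@zshift_continuous (t^-1)%g).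
  - exact: zshiftK.
  - exact: zshiftVK.
  - exact: zshift_continuous.
  - exact: (@zshift_continuous (t'^-1)%g).
  - exact: zshiftK.
  - exact: zshiftVK.
exists (agree l p3), (D0 `&` [set x | comeager [set g | D0 (flip g x)]]).
split.
- split; first exact: cyl_open cX _ _.
    by exists p3; exact: cyl_refl cX _ _.
  by move=> x /lU3/U32/U21[].
- by apply: comeagerI => //; exact: comeager_flip.
move=> u g pu pv [D0u cu] [D0v _].
pose g0 : bit_flips := fun j => if (rank (t' * j)%g < n)%N then g j else 0%N.
pose L := maxn l (rank t + rank t' + n).
(* The prescription g0 fixes only finitely many coordinates of the flip from u
   to z; the others are generic, which puts z in D0. *)
have [g' D0z g0g'] := comeager_meets cG cu (cyl_open cG L g0)
  (ex_intro _ g0 (cyl_refl cG L g0)).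
pose z := flip g' u.
have pz : agree l p3 z.
  move=> j rj m ml; rewrite /z /flip -g0g'; last by rewrite leq_max rj.
  rewrite /g0; case: ifP => _; first exact: pv.
  by rewrite PeanoNat.Nat.bits_0 addbF; exact: pu.
have window s i : (s = t \/ s = t') -> (rank i < n)%N ->
    (rank (s^-1 * i)%g < L)%N.
  move=> st ri; rewrite leq_max; apply/orP; right.
  apply: leq_ltn_trans (rankM _ _) _; rewrite rankV.
  by rewrite -addnS leq_add//; case: st => ->; rewrite ?leq_addr ?leq_addl.
have in_U1 x : agree l p3 x -> U1 x by move=> /lU3/U32/U21.
have ut : close (e + e) (f (zshift t u)) (f (zshift t z)).
  rewrite /z zshift_flip; apply: DP.
  - by case: D0u => _ [].
  - by rewrite -zshift_flip; case: D0z => _ [].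
  - by have [_ []] := in_U1 u pu.
  - by rewrite -zshift_flip; have [_ []] := in_U1 z pz.
  - move=> i ri; rewrite -g0g'; last by apply: window => //; left.
    rewrite /g0; have [_ _] := far (t^-1 * i)%g; rewrite mulVKg => /(_ ri).
    by rewrite leqNgt => /negbTE ->.
have vE : flip g u = flip (flip_mul g' g) z by rewrite -flip_flip /z flipK.
have tv : close (e + e) (f (zshift t' z)) (f (zshift t' (flip g u))).
  rewrite vE zshift_flip; apply: DP.
  - by case: D0z => _ [].
  - by rewrite -zshift_flip -vE; case: D0v => _ [].
  - by have [_ []] := in_U1 z pz.
  - by rewrite -zshift_flip -vE; have [_ []] := in_U1 _ pv.
  - move=> i ri; rewrite /flip_mul -g0g'; last by apply: window => //; right.
    by rewrite /g0 mulVKg ri PeanoNat.Nat.lxor_nilpotent.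
have untwist w s x y : close e (act w (f x)) (f (zshift s x)) ->
    close e (act w (f y)) (f (zshift s y)) ->
    close (e + e) (f (zshift s x)) (f (zshift s y)) ->
    close (e + e + e + e) (f x) (f y).
  move=> nx /close_sym ny nxy; apply/(close_act _ w).
  by rewrite -(addrA e); exact: close_trans (close_trans nx nxy) ny.
have n1 : close (e + e + e + e) (f u) (f z).
  have [[D2u _] _] := D0u; have [[D2z _] _] := D0z.
  by apply: untwist ut; apply: D2P => //; apply/U32/lU3.
have n2 : close (e + e + e + e) (f z) (f (flip g u)).
  have [[_ D3v] _] := D0v; have [[_ D3z] _] := D0z.
  by apply: untwist tv; apply: D3P => //; exact: lU3.
have -> : 8 * e = e + e + e + e + (e + e + e + e) by lra.
exact: close_trans n1 n2.
Qed.

(** For each j the sets provided by [locally_constant_on_flips] inside the basic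
    open sets have a dense union, so a generic x lies in one of them; flips of
    a generic y approach x inside these sets. *)
Lemma generic_single_orbit :
  exists2 D, comeager D & forall x y, D x -> D y -> orbit_rel act (f x) (f y).
Proof.
have [b [ob bb]] := cyl_countable_base cX.
have e0 j : 0 < 2 ^- j / 8 :> R by rewrite divr_gt0// invr_gt0 exprn_gt0.
have VDP (m j : nat) : exists VD : set cantor_seqs * set cantor_seqs,
    [/\ open VD.1 /\ VD.1 `<=` b m, b m !=set0 -> VD.1 !=set0, comeager VD.2 &
    forall u g, VD.1 u -> VD.1 (flip g u) -> VD.2 u -> VD.2 (flip g u) ->
      close (2 ^- j) (f u) (f (flip g u))].
  have [bm0|bm0] := pselect (b m !=set0); last first.
    exists (set0, setT); split=> [|/bm0//||//] /=; last exact: comeagerT.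
    by split; [exact: open0|exact: sub0set].
  have [V [D [[oV V0 Vb] cD DP]]] :=
    locally_constant_on_flips (e0 j) (ob m) bm0.
  exists (V, D); split=> //= u g Vu Vv Du Dv.
  have E : 2 ^- j = 8 * (2 ^- j / 8) :> R by move: (2 ^- j) => r; lra.
  rewrite E; exact: DP.
pose VD m j := projT1 (cid (VDP m j)).
pose D1 := C `&` \bigcap_m \bigcap_j (VD m j).2.
pose G := \bigcap_j \bigcup_m (VD m j).1.
have cD1 : comeager (D1 `&` G).
  apply: comeagerI; first apply: comeagerI => //.
    apply: comeager_bigcap => m; apply: comeager_bigcap => j.
    by rewrite /VD; case: cid => ? [].
  apply: comeager_bigcap => j; apply: comeager_open_dense.
    by apply: bigcup_open => m _; rewrite /VD; case: cid => ? [[]].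
  move=> Q oQ [x Qx]; have [m bx bQ] := bb x Q (open_nbhs_nbhs (conj oQ Qx)).
  have : (VD m j).1 !=set0 /\ (VD m j).1 `<=` b m.
    rewrite /VD; case: cid => ? /= [[_ ?] V0 _ _].
    by split=> //; apply: V0; exists x.
  by move=> [[z Vz] Vb]; exists z; split; [exists m|exact/bQ/Vb].
exists (D1 `&` G `&` [set x | comeager [set g | D1 (flip g x)]]).
  apply: comeagerI => //; apply: comeager_flip.
  by apply: comeager_sub cD1 => x [].
move=> y x [_ cy] [[[Cx D1x] Gx] _].
have /choice[mn nV] j : exists mn : nat * nat, agree mn.2 x `<=` (VD mn.1 j).1.
  have [m _ Vx] := Gx j I.
  have [|n nV] := open_cyl cX _ Vx; last by exists (m, n).
  by rewrite /VD; case: cid => ? [[]].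
pose m j := (mn j).1; pose n j := (mn j).2.
(* Stage j has to lie in the open sets chosen for both j and j-1, because two
   consecutive stages are compared in the open set chosen for the first. *)
have /choice[g gP] j : exists g, D1 (flip g y) /\
    agree (maxn j (maxn (n j) (n j.-1))) x (flip g y).
  have [g0 g0x] := flip_dense (maxn j (maxn (n j) (n j.-1))) x y.
  have [||g Dg gx] := comeager_meets cG cy
    (_ : open ([set g | agree (maxn j (maxn (n j) (n j.-1))) x (flip g y)])) _.
  - apply: open_comp; first by move=> z _; exact: flip_continuousr.
    exact: cyl_open cX _ _.
  - by exists g0.
  - by exists g.
pose z j := flip (g j) y.
have [zD zx] : (forall j, D1 (z j)) /\
    (forall j, agree (maxn j (maxn (n j) (n j.-1))) x (z j)).
  by split=> j; have [] := gP j.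
have zS j : z j.+1 = flip (flip_mul (g j) (g j.+1)) (z j).
  by rewrite -flip_flip /z flipK.
have close_z j : close (2 ^- j) (f (z j)) (f (z j.+1)).
  have zV : (VD (m j) j).1 (z j).
    by apply/nV/(cyl_le cX _ (zx j)); rewrite !leq_max leqnn orbT.
  have zSV : (VD (m j) j).1 (z j.+1).
    by apply/nV/(cyl_le cX _ (zx j.+1)); rewrite !leq_max leqnn !orbT.
  have zDj : (VD (m j) j).2 (z j) by have [_ /(_ (m j) I j I)] := zD j.
  have zSDj : (VD (m j) j).2 (z j.+1) by have [_ /(_ (m j) I j I)] := zD j.+1.
  move: zV zSV zDj zSDj; rewrite zS /VD; case: cid => ? /= [_ _ _]; exact.
have [w wE] := f_hom (jump_flip (g 0%N) y).
have z_lim A : nbhs (f x) A -> exists N, forall j, (N <= j)%N -> A (f (z j)).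
  move=> xA; have [Q /(cyl_nbhs cX)[N NQ] QA] := f_cont Cx xA.
  exists N => j Nj; apply: QA; last by have [] := zD j.
  by apply/NQ/(cyl_le cX _ (zx j)); rewrite leq_max Nj.
have [h hE] := orbit_limit dH d_inv act_cont dY_compat d_complete close_z z_lim.
by exists (h * w)%g; have [_ -> _] := act_cont; rewrite wE.
Qed.

End homomorphism.

Theorem corollary2p3 (R : realType) (H : topologicalGroupType)
    (Y : topologicalType) (act : H -> Y -> Y) :
  polish R H -> TSI R H -> polish R Y -> continuous_action act ->
  @generically_ergodic {ptws Zgrp -> cantor_space} Y
    (jump (Gamma := Zgrp) E0) (orbit_rel act).
Proof.
move=> [H_sep [dc [dcH dc_complete]]] [d dH d_inv].
move=> [Y_sep [dY [dY_compat _]]] act_cont f mf f_hom.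
have d_complete := tsi_complete dH d_inv dcH dc_complete.
have [b bb] := metric_countable_base dY_compat (f point) Y_sep.
have [C cC f_cont] := baire_measurable_continuous_on bb mf.
exact: (generic_single_orbit dH d_inv d_complete H_sep dY_compat act_cont
  f_hom cC f_cont).
Qed.
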